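(* Let $L\ge0$, $N=2L+1$, $\lambda>0$, $\tau\ge0$, and $f\in C(\mathbb{S}^1)$. Suppose $\beta_{\ell,k}=\tau$ for all $\ell,k$. Then the polynomial $$p^\beta_{\lambda,L,N}(x)=\sum_{\ell=0}^L\sum_{k=1}^{\gamma_\ell+1}\frac{\langle f,Y_{\ell,k}\rangle_N}{1+\lambda\beta_{\ell,k}^2}Y_{\ell,k}(x)$$ can be written in the regularized barycentric form $$p^\beta_{\lambda,L,N}(x)=\frac{1}{1+\lambda\tau^2}\;\frac{\sum_{j=1}^N(-1)^jf(x_j)\csc\frac{x-x_j}{2}}{\sum_{j=1}^N(-1)^j\csc\frac{x-x_j}{2}},$$ for every $x$ different (mod $2\pi$) from the nodes $x_1,\dots,x_N$.
   Context: Points $(\cos\theta,\sin\theta)^T$ of the unit circle $\mathbb{S}^1$ are identified with angles $\theta\in[-\pi,\pi]$ (mod $2\pi$), and in $\csc\frac{x-x_j}{2}=1/\sin\frac{x-x_j}{2}$ the symbols $x,x_j$ denote angles. $C(\mathbb{S}^1)$ is the space of real continuous functions on $\mathbb{S}^1$. Put $Y_{0,1}=1/\sqrt{2\pi}$, $Y_{\ell,1}(x)=\cos(\ell x)/\sqrt\pi$, $Y_{\ell,2}(x)=\sin(\ell x)/\sqrt\pi$ for $\ell\ge1$; $\gamma_0=0$ and $\gamma_\ell=1$ for $\ell\ge1$. The nodes $x_1<x_2<\dots<x_N$ are equidistant angles with step $x_{j+1}-x_j=2\pi/N$ (trapezoidal rule nodes). The discrete inner product is $\langle v,z\rangle_N=\frac{2\pi}{N}\sum_{j=1}^Nv(x_j)z(x_j)$.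 *)

(* Defs.v *)
From mathcomp Require Import all_boot all_order all_algebra.
From mathcomp Require Import all_classical all_reals all_analysis.
Set Implicit Arguments.
Unset Strict Implicit.
Unset Printing Implicit Defensive.
Import Order.TTheory GRing.Theory Num.Theory.
Import numFieldNormedType.Exports.
Local Open Scope classical_set_scope.
Local Open Scope ring_scope.

Definition unit_circle (R : realType) : set (R * R) :=
  [set p | p.1 ^+ 2 + p.2 ^+ 2 = 1].

(* A function [f] on the circle is read at an angle [t] as
   [f (circle_point t)]. *)
Definition circle_point (R : realType) (t : R) : R * R := (cos t, sin t).

Definition csc (R : realType) (t : R) : R := (sin t)^-1.

Definition gamma (l : nat) : nat := if l == 0%N then 0%N else 1%N.

(* The pair [(l, k)] is meaningful for [1 <= k <= gamma l + 1] only. *)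
Definition Y (R : realType) (l k : nat) (t : R) : R :=
  if l == 0%N then 1 / Num.sqrt (2 * pi)
  else if k == 1%N then cos (l%:R * t) / Num.sqrt pi
  else sin (l%:R * t) / Num.sqrt pi.

(* Nodes are the values [x 1, ..., x N]; [x] is irrelevant elsewhere. The
   [x j] are real representatives of angles whose consecutive differences are
   exactly [2 pi / N], not only modulo [2 pi]: the signs of the half-angle
   cosecants depend on this choice. *)
Definition equidistant_nodes (R : realType) (N : nat) (x : nat -> R) : Prop :=
  forall j : nat, (1 <= j < N)%N -> x j.+1 - x j = 2 * pi / N%:R.

Definition discrete_inner (R : realType) (N : nat) (x : nat -> R)
    (v z : R -> R) : R :=
  2 * pi / N%:R * \sum_(1 <= j < N.+1) v (x j) * z (x j).

Definition regularized_poly (R : realType) (lambda : R) (L N : nat)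
    (beta : nat -> nat -> R) (x : nat -> R) (f : R -> R) (t : R) : R :=
  \sum_(0 <= l < L.+1) \sum_(1 <= k < (gamma l + 1).+1)
    discrete_inner N x f (@Y R l k) / (1 + lambda * beta l k ^+ 2) * Y l k t.

(* Main.v *)
Require Import Defs.
From mathcomp Require Import all_boot all_order all_algebra.
From mathcomp Require Import all_classical all_reals all_analysis.
From mathcomp Require Import ring lra zify.
Import Order.TTheory GRing.Theory Num.Theory.
Import numFieldNormedType.Exports.
Local Open Scope classical_set_scope.
Local Open Scope ring_scope.

(** When every [beta l k] equals [tau], the filter is a constant factor
    [1 / (1 + lambda tau^2)] and what remains is an interpolation formula.
    The addition theorem [sum_YY] collapses the basis functions into the
    Dirichlet kernel [D u = 1 + 2 cos u + ... + 2 cos (L u)], so that the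
    polynomial is the constant factor times the mean of [f (x j) D (t - x j)]
    over the nodes.

    Two facts about [D] then suffice. First, [D u sin (u / 2) = sin (N u / 2)]
    with [N = 2 L + 1] ([dirichlet_sin]). Going from a node to the next changes
    [N u / 2] by exactly [pi], so [sin (N (t - x j) / 2)] is [- (-1) ^ j S] with
    [S = sin (N (t - x 1) / 2)], and [D (t - x j)] is
    [- S (-1) ^ j csc ((t - x j) / 2)] ([dirichlet_csc]). Second, the kernels
    [D (t - x j)] sum to [N], because the frequencies [1, ..., L] are not
    multiples of [N] and hence average to zero over the nodes
    ([sum_dirichlet_nodes]).

    Summing the first identity over [j] and comparing with the second gives
    [- S W = N] for the barycentric denominator [W]. Hence [W] is nonzero, and
    the factor [- S / N] in front of the numerator is [1 / W]. *)

(** * Trigonometric identities *)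

Lemma sin_shift_pin (R : realType) (n : nat) (z : R) :
  sin (z - n%:R * pi) = (-1) ^+ n * sin z.
Proof.
elim: n z => [|n IHn] z; first by rewrite mul0r subr0 mul1r.
have -> : z - n.+1%:R * pi = (z - pi) - n%:R * pi by rewrite -natr1; ring.
by rewrite IHn sinB cospi sinpi exprS; ring.
Qed.

(** Subtracting [floor (z / pi)] times [pi] changes the sine by a sign at most
    and moves [z] into the interval from [0] included to [pi] excluded, where
    the sine vanishes only at [0]. *)
Lemma sin_eq0_pi (R : realType) (z : R) :
  sin z = 0 -> exists m : int, z = m%:~R * pi.
Proof.
move=> sz0; exists (Num.floor (z / pi)).
have pi0 := pi_gt0 R.
set m := Num.floor _.
have sin_r : sin (z - m%:~R * pi) = 0.
  case: m => n; first by rewrite -pmulrn sin_shift_pin sz0 mulr0.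
  have := sin_shift_pin R n.+1 (z - (Negz n)%:~R * pi).
  rewrite {1}NegzE rmorphN /= -pmulrn mulNr opprK addrK sz0 => /esym/eqP.
  by rewrite mulf_eq0 signr_eq0 /= => /eqP.
have lez : m%:~R * pi <= z by rewrite -ler_pdivlMr // floor_le_tmp.
have ltz : z < m%:~R * pi + pi.
  rewrite -[X in _ + X]mul1r -mulrDl -ltr_pdivrMr //.
  by have := floorD1_gt (z / pi); rewrite intrD.
case: (ltrP 0 (z - m%:~R * pi)) => [r_gt0|]; last by lra.
by have : 0 < sin (z - m%:~R * pi);
  [apply: sin_gt0_pi; rewrite r_gt0 /=; lra | rewrite sin_r ltxx].
Qed.

(** Multiplying by twice the sine of half the step makes the sum telescope. *)
Lemma sum_cos_arith (R : realType) (n : nat) (a h : R) :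
  2 * sin (h / 2) * (\sum_(0 <= i < n) cos (a + i%:R * h)) =
  sin (a - h / 2 + n%:R * h) - sin (a - h / 2).
Proof.
elim: n => [|n IHn]; first by rewrite big_geq // mul0r addr0 subrr mulr0.
rewrite big_nat_recr //= mulrDr IHn.
have -> : a - h / 2 + n.+1%:R * h = (a + n%:R * h) + h / 2.
  by rewrite -natr1; field.
have -> : a - h / 2 + n%:R * h = (a + n%:R * h) - h / 2 by ring.
by rewrite (sinB (a + _)) (sinD (a + n%:R * h) (h / 2)); ring.
Qed.

(** For [0 < l < N] the step [2 pi l / N] is not a multiple of [2 pi], while
    [N] steps make [l] full turns: the telescoped sum closes up. *)
Lemma sum_cos_roots (R : realType) (l N : nat) (a : R) : (0 < l < N)%N ->
  \sum_(0 <= i < N) cos (a + i%:R * (- (2 * pi * l%:R / N%:R))) = 0.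
Proof.
move=> /andP[l_gt0 lN].
have pi0 := pi_gt0 R.
have N_gt0 : (0 < N)%N by exact: ltn_trans lN.
have N0 : 0 < N%:R :> R by rewrite ltr0n.
set h := - _.
have sh0 : sin (h / 2) != 0.
  have -> : h / 2 = - (pi * (l%:R / N%:R)) by rewrite /h; field; lra.
  rewrite sinN oppr_eq0 gt_eqF // sin_gt0_pi //.
  rewrite mulr_gt0 ?divr_gt0 ?ltr0n //=.
  by rewrite gtr_pMr // ltr_pdivrMr // mul1r ltr_nat.
have /eqP := sum_cos_arith R N a h.
have -> : a - h / 2 + N%:R * h = a - h / 2 - (2 * l)%N%:R * pi.
  by rewrite /h natrM; field; lra.
rewrite sin_shift_pin mulnC exprM sqrr_sign mul1r subrr.
by rewrite !mulf_eq0 (negbTE sh0) pnatr_eq0 /= => /eqP.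
Qed.

(** * The Dirichlet kernel *)

Definition dirichlet (R : realType) (L : nat) (u : R) : R :=
  1 + 2 * \sum_(1 <= l < L.+1) cos (l%:R * u).

Lemma dirichlet_sin (R : realType) (L : nat) (u : R) :
  dirichlet R L u * sin (u / 2) = sin ((2 * L + 1)%N%:R * (u / 2)).
Proof.
have -> : dirichlet R L u =
    1 + 2 * \sum_(0 <= i < L) cos (u + i%:R * u).
  rewrite /dirichlet big_add1 /=; congr (1 + 2 * _).
  by apply: eq_bigr => i _; rewrite -natr1 mulrDl mul1r addrC.
have -> : (2 * L + 1)%N%:R * (u / 2) = u - u / 2 + L%:R * u.
  by rewrite natrD natrM; field.
have := sum_cos_arith R L u u.
have -> : sin (u - u / 2) = sin (u / 2) by congr sin; field.
by move=> /eqP; rewrite eq_sym subr_eq => /eqP ->; ring.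
Qed.

(** The addition theorem: in each degree, the cosine of the difference formula
    merges the two products into one cosine. *)
Lemma sum_YY (R : realType) (L : nat) (s t : R) :
  \sum_(0 <= l < L.+1) \sum_(1 <= k < (gamma l + 1).+1) Y l k s * Y l k t =
  dirichlet R L (t - s) / (2 * pi).
Proof.
have pi0 := pi_gt0 R.
rewrite big_nat_recl // big_nat1 /Y /=.
have -> : 1 / Num.sqrt (2 * pi) * (1 / Num.sqrt (2 * pi)) = 1 / (2 * pi) :> R.
  by rewrite mulf_div mulr1 -expr2 sqr_sqrtr //; lra.
rewrite /dirichlet [RHS]mulrDl; congr (_ + _).
rewrite big_add1 /= mulrAC mulr_sumr; apply: eq_bigr => l _.
rewrite big_nat_recr //= big_nat1 /=.
rewrite !mulf_div -!expr2 sqr_sqrtr ?(ltW pi0) //.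
by rewrite mulrBr cosB; field; lra.
Qed.

(** * Equidistant nodes *)

Lemma nodeE (R : realType) (N : nat) (x : nat -> R) (i : nat) :
  equidistant_nodes N x -> (i < N)%N ->
  x i.+1 = x 1%N + i%:R * (2 * pi / N%:R).
Proof.
move=> hx; elim: i => [|i IHi] iN; first by rewrite mul0r addr0.
have /eqP := hx i.+1 iN; rewrite subr_eq => /eqP ->.
by rewrite IHi ?(ltnW iN) // -[i.+1%:R]natr1; ring.
Qed.

Lemma sum_dirichlet_nodes (R : realType) (L : nat) (x : nat -> R) (t : R) :
  equidistant_nodes (2 * L + 1) x ->
  \sum_(1 <= j < (2 * L + 1).+1) dirichlet R L (t - x j) = (2 * L + 1)%N%:R.
Proof.
set N := (2 * L + 1)%N => hx.
have N0 : N%:R != 0 :> R by rewrite pnatr_eq0 /N addn1.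
rewrite big_split /= -mulr_sumr exchange_big /=.
rewrite [X in _ + 2 * X]big_nat_cond [X in _ + 2 * X]big1 => [|l]; last first.
  rewrite andbT => /andP[l_gt0 lL].
  rewrite big_add1 /= -[RHS](sum_cos_roots R l N (l%:R * (t - x 1%N))); last first.
    by rewrite l_gt0 /N; lia.
  apply: eq_big_nat => i /andP[_ iN]; congr cos.
  by rewrite (nodeE _ _ _ _ hx iN); field.
by rewrite mulr0 addr0 sumr_const_nat subSS subn0.
Qed.

(** This is where the alternating weights [(-1) ^ j] come from: the numerator
    of the kernel is the sine of an angle that drops by [pi] at each node. *)
Lemma dirichlet_csc (R : realType) (L : nat) (x : nat -> R) (t : R) (j : nat) :
  equidistant_nodes (2 * L + 1) x -> (1 <= j <= 2 * L + 1)%N ->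
  sin ((t - x j) / 2) != 0 ->
  dirichlet R L (t - x j) =
  - sin ((2 * L + 1)%N%:R * ((t - x 1%N) / 2)) *
    ((-1) ^+ j * csc ((t - x j) / 2)).
Proof.
case: j => // i hx iN s0.
apply: (mulIf s0); rewrite dirichlet_sin /csc -!mulrA mulVf // mulr1.
have N0 : (2 * L + 1)%N%:R != 0 :> R by rewrite pnatr_eq0 addn1.
have -> : (2 * L + 1)%N%:R * ((t - x i.+1) / 2) =
    (2 * L + 1)%N%:R * ((t - x 1%N) / 2) - i%:R * pi.
  by rewrite (nodeE _ _ _ _ hx iN); field.
by rewrite sin_shift_pin exprS; ring.
Qed.

(** Keeps the cosecants away from the junk value of the inverse at zero. *)
Lemma half_angle_sin_neq0 (R : realType) (y t : R) :
  (forall m : int, t <> y + m%:~R * (2 * pi)) -> sin ((t - y) / 2) != 0.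
Proof.
move=> ht; apply/eqP => /sin_eq0_pi[m hm]; apply: (ht m).
by apply: (@addIr _ (- y)); rewrite addrAC subrr add0r mulrCA -hm; field.
Qed.

(** * The barycentric form *)

Lemma regularized_poly_dirichlet (R : realType) (lambda tau : R) (L N : nat)
    (beta : nat -> nat -> R) (x : nat -> R) (g : R -> R) (t : R) :
  (0 < N)%N ->
  (forall l k : nat, (l <= L)%N -> (1 <= k <= gamma l + 1)%N ->
    beta l k = tau) ->
  regularized_poly lambda L N beta x g t =
  1 / (1 + lambda * tau ^+ 2) *
    (N%:R^-1 * \sum_(1 <= j < N.+1) g (x j) * dirichlet R L (t - x j)).
Proof.
move=> N_gt0 hbeta.
have pi0 : pi != 0 :> R by rewrite gt_eqF // pi_gt0.
have N0 : N%:R != 0 :> R by rewrite pnatr_eq0 -lt0n.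
have -> : N%:R^-1 * \sum_(1 <= j < N.+1) g (x j) * dirichlet R L (t - x j) =
    2 * pi / N%:R * \sum_(1 <= j < N.+1) g (x j) *
      (\sum_(0 <= l < L.+1) \sum_(1 <= k < (gamma l + 1).+1)
         Y l k (x j) * Y l k t).
  rewrite !mulr_sumr; apply: eq_bigr => j _; rewrite sum_YY.
  by move: (@pi R) pi0 => p p0; field; rewrite p0.
under eq_bigr do rewrite mulr_sumr.
rewrite exchange_big !mulr_sumr; apply: eq_big_nat => l /andP[_ lL].
under [in RHS]eq_bigr do rewrite mulr_sumr.
rewrite exchange_big !mulr_sumr; apply: eq_big_nat => k /andP[k1 kl].
rewrite hbeta // ?k1 // /discrete_inner.
under [in RHS]eq_bigr do rewrite mulrA.
by rewrite -mulr_suml; ring.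
Qed.

Theorem theorem3p3 (R : realType) (L N : nat) (hN : N = (2 * L + 1)%N)
    (lambda tau : R) (hlambda : 0 < lambda) (htau : 0 <= tau)
    (f : R * R -> R) (hf : {within @unit_circle R, continuous f})
    (beta : nat -> nat -> R)
    (hbeta : forall l k : nat, (l <= L)%N -> (1 <= k <= gamma l + 1)%N ->
       beta l k = tau)
    (x : nat -> R) (hx : equidistant_nodes N x)
    (t : R)
    (ht : forall (j : nat) (m : int), (1 <= j <= N)%N ->
       t <> x j + m%:~R * (2 * pi)) :
  \sum_(1 <= j < N.+1) (-1) ^+ j * csc ((t - x j) / 2) != 0 /\
  regularized_poly lambda L N beta x (fun s => f (circle_point s)) t =
    1 / (1 + lambda * tau ^+ 2) *
    ((\sum_(1 <= j < N.+1)
        (-1) ^+ j * f (circle_point (x j)) * csc ((t - x j) / 2)) /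
     (\sum_(1 <= j < N.+1) (-1) ^+ j * csc ((t - x j) / 2))).
Proof.
have N_gt0 : (0 < N)%N by rewrite hN addn1.
have N0 : N%:R != 0 :> R by rewrite pnatr_eq0 -lt0n.
rewrite (regularized_poly_dirichlet _ _ _ _ _ _ _ _ _ N_gt0 hbeta).
set W := (X in X != 0 /\ _).
pose S := sin (N%:R * ((t - x 1%N) / 2)).
have kernelE j : (1 <= j < N.+1)%N ->
    dirichlet R L (t - x j) = - S * ((-1) ^+ j * csc ((t - x j) / 2)).
  move=> jN; have s0 : sin ((t - x j) / 2) != 0.
    by apply: half_angle_sin_neq0 => m; apply: ht.
  by rewrite /S; subst N; exact: dirichlet_csc.
(* The case of the constant function 1, which the unregularized sum
   reproduces. *)
have SW : - S * W = N%:R.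
  rewrite /W mulr_sumr -(eq_big_nat _ _ kernelE).
  by subst N; exact: sum_dirichlet_nodes.
have W0 : W != 0 by apply: contra_eq_neq SW => ->; rewrite mulr0 eq_sym.
split=> //; congr (_ * _).
have -> : \sum_(1 <= j < N.+1)
      f (circle_point (x j)) * dirichlet R L (t - x j) =
    - S * \sum_(1 <= j < N.+1)
      (-1) ^+ j * f (circle_point (x j)) * csc ((t - x j) / 2).
  by rewrite mulr_sumr; apply: eq_big_nat => j /kernelE ->; ring.
rewrite -SW mulf_eq0 negb_or in N0; case/andP: N0 => S0 _.
by rewrite -SW -/W invfM mulrACA mulVf // mul1r mulrC.
Qed.
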